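(* Up to isomorphism, the nondistributive lattices with $5$ or $6$ elements are exactly the following twelve pairwise non-isomorphic lattices, and their outer and inner median lattices are as listed. Here each lattice is given by its elements and by its covering relations ($u\prec v$ means that $v$ covers $u$), $0$ is the least and $1$ the greatest element. 1. $M_3=\{0,a,b,c,1\}$, $0\prec a,b,c\prec 1$: $\mathrm{OutMed}(M_3)\cong M_3$, $\mathrm{InnMed}(M_3)\cong\mathbf 2$. 2. $N_5=\{0,a,b,c,1\}$, $0\prec a\prec c\prec 1$, $0\prec b\prec 1$: $\mathrm{OutMed}(N_5)\cong\mathbf 2$, $\mathrm{InnMed}(N_5)\cong\mathbf 2$. 3. $M_4=\{0,a,b,c,d,1\}$, $0\prec a,b,c,d\prec 1$: $\mathrm{OutMed}(M_4)\cong M_4^4$ (direct power), $\mathrm{InnMed}(M_4)\cong\mathbf 2$. 4. $A_1=\{0,a,b,c,d,1\}$, $0\prec a\prec c\prec 1$, $0\prec b\prec 1$, $0\prec d\prec 1$: $\mathrm{OutMed}(A_1)\cong\mathbf 2^2\times A_1^{[\mathbf 2]}$, where $A_1^{[\mathbf 2]}$ is the lattice of all monotone maps $\mathbf 2\to A_1$ under the pointwise order (in particular $|\mathrm{OutMed}(A_1)|=64$), and $\mathrm{InnMed}(A_1)\cong\mathbf 2^2$. 5. $A_2=\{0,a,b,c,d,1\}$, $0\prec a\prec c\prec 1$, $0\prec b\prec d\prec 1$: $\mathrm{OutMed}(A_2)\cong\mathbf 3^2$, $\mathrm{InnMed}(A_2)\cong\mathbf 2$. 6. $A_3=\{0,a,b,c,d,1\}$,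 $0\prec a\prec c\prec d\prec 1$, $0\prec b\prec 1$: $\mathrm{OutMed}(A_3)$ is isomorphic to the eight-element lattice $\{p_1,\dots,p_8\}$ with covering relations $p_1\prec p_2$, $p_1\prec p_3$, $p_2\prec p_4$, $p_3\prec p_4$, $p_3\prec p_6$, $p_4\prec p_5$, $p_4\prec p_7$, $p_6\prec p_7$, $p_5\prec p_8$, $p_7\prec p_8$; and $\mathrm{InnMed}(A_3)\cong\mathbf 2$. 7 and 8. The two mutually dual lattices $L_4$ and $L_5$, one of which is $\{0,a,b,c,d,1\}$ with $0\prec a,b\prec d\prec 1$, $0\prec c\prec 1$, and the other of which is its dual: $\mathrm{OutMed}(L_4)\cong\mathrm{OutMed}(L_5)\cong\mathbf 3^2$, $\mathrm{InnMed}(L_4)\cong\mathrm{InnMed}(L_5)\cong\mathbf 3$. 9. $B_1$, obtained from $M_3$ by adding a new greatest element: $\mathrm{OutMed}(B_1)\cong M_3$, $\mathrm{InnMed}(B_1)\cong\mathbf 2$. 10. $B_2$, obtained from $M_3$ by adding a new least element: $\mathrm{OutMed}(B_2)\cong M_3$, $\mathrm{InnMed}(B_2)\cong\mathbf 2$. 11. $B_3$, obtained from $N_5$ by adding a new greatest element: $\mathrm{OutMed}(B_3)\cong\mathbf 2$, $\mathrm{InnMed}(B_3)\cong\mathbf 2$. 12. $B_4$, obtained from $N_5$ by adding a new least element: $\mathrm{OutMed}(B_4)\cong\mathbf 2$, $\mathrm{InnMed}(B_4)\cong\mathbf 2$.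
   Context: For a lattice $L$, a median of $L$ is a map $f:L^3\to L$ that is symmetric (invariant under all permutations of its three arguments), monotone (in each argument), and a majority operation, i.e. $f(x,x,y)=f(x,y,x)=f(y,x,x)=x$ for all $x,y\in L$. A median is inner if it is a term function, i.e. it is induced by a ternary lattice term (in the operations $\wedge,\vee$), and outer otherwise. The set of all medians of $L$ is a sublattice of $L^{L^3}$ (pointwise operations), called the outer median lattice $\mathrm{OutMed}(L)$; thus $\mathrm{OutMed}(L)$ contains all medians, inner ones included. The inner medians form a sublattice of it, the inner median lattice $\mathrm{InnMed}(L)$. $\mathbf 2$ and $\mathbf 3$ denote the two- and three-element chains; $\mathbf 2^2$ and $\mathbf 3^2$ are direct squares. *)

(* Defs.v *)
From HB Require Import structures.
From mathcomp Require Import all_boot all_order.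
From mathcomp Require Import boolp.

Set Implicit Arguments.
Unset Strict Implicit.
Unset Printing Implicit Defensive.

Import Order.TTheory.
Local Open Scope order_scope.

Definition lattice_iso d (L : latticeType d) d' (M : latticeType d') : Prop :=
  exists f : {lmorphism L -> M}, bijective f.

Definition distributive_lattice d (L : latticeType d) : Prop :=
  left_distributive (@Order.meet d L) (@Order.join d L).

(* ------------------------------------------------------------------------ *)

Section OutMed.
Context (d : Order.disp_t) (L : latticeType d).
Implicit Types f g : L * L * L -> L.

Definition symmetric3 f : Prop := forall x y z,
  [/\ f (x, z, y) = f (x, y, z), f (y, x, z) = f (x, y, z),
      f (y, z, x) = f (x, y, z), f (z, x, y) = f (x, y, z)
    & f (z, y, x) = f (x, y, z)].

Definition monotone3 f : Prop := forall x x' y y' z z',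
  x <= x' -> y <= y' -> z <= z' -> f (x, y, z) <= f (x', y', z').

Definition majority f : Prop := forall x y,
  [/\ f (x, x, y) = x, f (x, y, x) = x & f (y, x, x) = x].

Definition median f : Prop := [/\ symmetric3 f, monotone3 f & majority f].

Lemma median_meet f g : median f -> median g -> median (f `&` g).
Proof.
move=> [sf mf jf] [sg mg jg]; split.
- by move=> x y z; case: (sf x y z) => f1 f2 f3 f4 f5;
    case: (sg x y z) => g1 g2 g3 g4 g5;
    rewrite !meetfE f1 f2 f3 f4 f5 g1 g2 g3 g4 g5.
- by move=> x x' y y' z z' hx hy hz; rewrite !meetfE leI2 ?mf ?mg.
- by move=> x y; case: (jf x y) => f1 f2 f3; case: (jg x y) => g1 g2 g3;
    rewrite !meetfE f1 f2 f3 g1 g2 g3 meetxx.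
Qed.

Lemma median_join f g : median f -> median g -> median (f `|` g).
Proof.
move=> [sf mf jf] [sg mg jg]; split.
- by move=> x y z; case: (sf x y z) => f1 f2 f3 f4 f5;
    case: (sg x y z) => g1 g2 g3 g4 g5;
    rewrite !joinfE f1 f2 f3 f4 f5 g1 g2 g3 g4 g5.
- by move=> x x' y y' z z' hx hy hz; rewrite !joinfE leU2 ?mf ?mg.
- by move=> x y; case: (jf x y) => f1 f2 f3; case: (jg x y) => g1 g2 g3;
    rewrite !joinfE f1 f2 f3 g1 g2 g3 joinxx.
Qed.

(* The order on [L * L * L -> L] is the pointwise one of [boolp]; the domain
   is used as a plain type. *)
Record OutMed := MkOutMed {
  outmed_fun :> L * L * L -> L;
  _ : `[< median outmed_fun >] }.

HB.instance Definition _ := [isSub for outmed_fun].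
HB.instance Definition _ := [Choice of OutMed by <:].

Fact OutMed_meet_closed : meet_closed (fun f => `[< median f >]).
Proof.
by move=> f g /asboolP mf /asboolP mg; apply/asboolP; apply: median_meet.
Qed.

Fact OutMed_join_closed : join_closed (fun f => `[< median f >]).
Proof.
by move=> f g /asboolP mf /asboolP mg; apply/asboolP; apply: median_join.
Qed.

HB.instance Definition _ := Order.SubChoice_isSubLattice.Build
  _ _ _ FunOrder.fun_display OutMed OutMed_meet_closed OutMed_join_closed.

Lemma OutMed_meetE (f g : OutMed) t : (f `&` g) t = f t `&` g t.
Proof. by rewrite -meetfE; congr (_ t); exact: (omorphI (@outmed_fun) f g). Qed.

Lemma OutMed_joinE (f g : OutMed) t : (f `|` g) t = f t `|` g t.
Proof. by rewrite -joinfE; congr (_ t); exact: (omorphU (@outmed_fun) f g). Qed.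

End OutMed.

(* ------------------------------------------------------------------------ *)

(* Ternary lattice terms; [TX], [TY], [TZ] are the three variables. *)
Inductive lterm := TX | TY | TZ | TMeet of lterm & lterm | TJoin of lterm & lterm.

Section InnMed.
Context (d : Order.disp_t) (L : latticeType d).

Fixpoint lterm_eval (x y z : L) (t : lterm) : L :=
  match t with
  | TX => x
  | TY => y
  | TZ => z
  | TMeet s t => lterm_eval x y z s `&` lterm_eval x y z t
  | TJoin s t => lterm_eval x y z s `|` lterm_eval x y z t
  end.

Definition term_function (f : L * L * L -> L) : Prop :=
  exists t, forall x y z, f (x, y, z) = lterm_eval x y z t.

Record InnMed := MkInnMed {
  innmed_outmed :> OutMed L;
  _ : `[< term_function innmed_outmed >] }.

HB.instance Definition _ := [isSub for innmed_outmed].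
HB.instance Definition _ := [Choice of InnMed by <:].

Fact InnMed_meet_closed :
  meet_closed (fun f : OutMed L => `[< term_function f >]).
Proof.
move=> f g /asboolP[s fE] /asboolP[t gE]; apply/asboolP; exists (TMeet s t).
by move=> x y z; rewrite OutMed_meetE fE gE.
Qed.

Fact InnMed_join_closed :
  join_closed (fun f : OutMed L => `[< term_function f >]).
Proof.
move=> f g /asboolP[s fE] /asboolP[t gE]; apply/asboolP; exists (TJoin s t).
by move=> x y z; rewrite OutMed_joinE fE gE.
Qed.

HB.instance Definition _ := Order.SubChoice_isSubLattice.Build
  _ _ _ FunOrder.fun_display InnMed InnMed_meet_closed InnMed_join_closed.

End InnMed.

(* ------------------------------------------------------------------------ *)

(* [MonMaps P L] is the lattice L^[P] of monotone maps P -> L. *)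
Section MonMaps.
Context (dP : Order.disp_t) (P : porderType dP).
Context (d : Order.disp_t) (L : latticeType d).

Record MonMaps := MkMonMaps {
  monmap_fun :> P -> L;
  _ : `[< {homo monmap_fun : x y / x <= y} >] }.

HB.instance Definition _ := [isSub for monmap_fun].
HB.instance Definition _ := [Choice of MonMaps by <:].

Fact MonMaps_meet_closed :
  meet_closed (fun f : P -> L => `[< {homo f : x y / x <= y} >]).
Proof.
move=> f g /asboolP mf /asboolP mg; apply/asboolP => x y xy.
by rewrite !meetfE leI2 ?mf ?mg.
Qed.

Fact MonMaps_join_closed :
  join_closed (fun f : P -> L => `[< {homo f : x y / x <= y} >]).
Proof.
move=> f g /asboolP mf /asboolP mg; apply/asboolP => x y xy.
by rewrite !joinfE leU2 ?mf ?mg.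
Qed.

HB.instance Definition _ := Order.SubChoice_isSubLattice.Build
  _ _ _ FunOrder.fun_display MonMaps MonMaps_meet_closed MonMaps_join_closed.

End MonMaps.

(* ------------------------------------------------------------------------ *)

(* Finite lattices given by their covering relation: the elements are the
   ordinals below [n], a pair [(u, v)] of [c] says that v covers u, and the
   order is the reflexive transitive closure of [c]. *)
Definition cov_rel n (c : seq (nat * nat)) : rel 'I_n :=
  fun u v => (val u, val v) \in c.

Definition cov_le n (c : seq (nat * nat)) : rel 'I_n := connect (@cov_rel n c).

Record diagram := Diagram {
  diag_size : nat;
  diag_cov : seq (nat * nat);
  diag_anti : antisymmetric (@cov_le diag_size diag_cov);
  diag_meet : forall x y, exists m, forall z : 'I_diag_size,
    cov_le diag_cov z m = cov_le diag_cov z x && cov_le diag_cov z y;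
  diag_join : forall x y, exists m, forall z : 'I_diag_size,
    cov_le diag_cov m z = cov_le diag_cov x z && cov_le diag_cov y z;
  (* no pair is redundant: [diag_cov] is exactly the covering relation *)
  diag_covE : forall u v : 'I_diag_size, cov_rel diag_cov u v <->
    [/\ u != v, cov_le diag_cov u v & forall w,
        cov_le diag_cov u w -> cov_le diag_cov w v -> w = u \/ w = v] }.

Definition diag_elt (D : diagram) := 'I_(diag_size D).

Section DiagramLattice.
Variable D : diagram.
Local Notation le := (@cov_le (diag_size D) (diag_cov D)).

HB.instance Definition _ := Finite.on (diag_elt D).

Fact diagram_display : Order.disp_t. Proof. exact: (Order.Disp tt tt). Qed.

Let eltle : rel (diag_elt D) := le.

Fact eltle_refl : reflexive eltle. Proof. exact: connect0. Qed.
Fact eltle_anti : antisymmetric eltle. Proof. exact: diag_anti. Qed.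
Fact eltle_trans : transitive eltle. Proof. exact: connect_trans. Qed.

HB.instance Definition _ := Order.Le_isPOrder.Build
  diagram_display (diag_elt D) eltle_refl eltle_anti eltle_trans.

Fact elt_meet_ex (x y : diag_elt D) :
  exists m, [forall z, le z m == le z x && le z y].
Proof.
by have [m mP] := diag_meet x y; exists m; apply/forallP => z; rewrite mP.
Qed.

Fact elt_join_ex (x y : diag_elt D) :
  exists m, [forall z, le m z == le x z && le y z].
Proof.
by have [m mP] := diag_join x y; exists m; apply/forallP => z; rewrite mP.
Qed.

Definition elt_meet (x y : diag_elt D) : diag_elt D := xchoose (elt_meet_ex x y).
Definition elt_join (x y : diag_elt D) : diag_elt D := xchoose (elt_join_ex x y).

Fact elt_meetP (x y z : diag_elt D) :
  (x <= elt_meet y z) = (x <= y) && (x <= z).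
Proof. exact: eqP (forallP (xchooseP (elt_meet_ex y z)) x). Qed.

Fact elt_joinP (x y z : diag_elt D) :
  (elt_join x y <= z) = (x <= z) && (y <= z).
Proof. exact: eqP (forallP (xchooseP (elt_join_ex x y)) z). Qed.

HB.instance Definition _ := Order.POrder_MeetJoin_isLattice.Build
  diagram_display (diag_elt D) elt_meetP elt_joinP.

End DiagramLattice.

Coercion diag_lattice (D : diagram) : finLatticeType diagram_display :=
  diag_elt D.

(* ------------------------------------------------------------------------ *)

(* A computable form of [cov_le], used to check concrete diagrams. *)
Fixpoint reach (c : seq (nat * nat)) (k x y : nat) : bool :=
  (x == y) ||
  (if k is k'.+1 then has (fun p => (p.1 == x) && reach c k' p.2 y) c
   else false).

Lemma cov_leE n c (x y : 'I_n) :
  all (fun p => (p.1 < n)%N && (p.2 < n)%N) c ->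
  cov_le c x y = reach c n x y.
Proof.
move=> /allP cn; apply/idP/idP.
- case/connectP => p0 p0P ->; case: (shortenP p0P) => p pP up _ {p0 p0P}.
  have sp : (size p <= n)%N.
    have := max_card (mem (x :: p)).
    by rewrite card_ord (card_uniqP up) /= => /ltnW.
  suff reachP k : (size p <= k)%N -> reach c k x (last x p) by exact: reachP.
  elim: p x pP k {up sp} => [|z p IHp] x /= pP [|k] //= sp; rewrite ?eqxx //.
  case/andP: pP => xz zp; apply/orP; right; apply/hasP.
  by exists (val x, val z); rewrite //= eqxx IHp.
- move: {1}n => k; elim: k x => [|k IHk] x /=.
    by rewrite orbF => /eqP /val_inj ->; exact: connect0.
  case/orP => [/eqP /val_inj -> | /hasP [[u v] uv /= /andP [/eqP ux vy]]].
    exact: connect0.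
  have /andP [_ /= vn] := cn _ uv.
  apply: (@connect_trans _ _ (Ordinal vn)); last exact: IHk.
  by apply: connect1; rewrite /cov_rel /= -ux.
Qed.

Section Check.
Variables (n : nat) (c : seq (nat * nat)).
Let le := reach c n.
Let it := iota 0 n.

Definition check_diagram : bool :=
  [&& all (fun p => (p.1 < n)%N && (p.2 < n)%N) c,
      all (fun x => all (fun y => (le x y && le y x) ==> (x == y)) it) it,
      all (fun x => all (fun y => has (fun m => all (fun z =>
        le z m == le z x && le z y) it) it) it) it,
      all (fun x => all (fun y => has (fun m => all (fun z =>
        le m z == le x z && le y z) it) it) it) it
    & all (fun u => all (fun v => ((u, v) \in c) ==
        [&& u != v, le u v & all (fun w => le u w && le w v ==>
          ((w == u) || (w == v))) it]) it) it].

Hypothesis ok : check_diagram.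

Let allI (P : pred nat) (x : 'I_n) : all P it -> P x.
Proof. by move/allP; apply; rewrite mem_iota add0n ltn_ord. Qed.

Let hasI (P : pred nat) : has P it -> exists x : 'I_n, P x.
Proof.
by case/hasP => x; rewrite mem_iota add0n => /= xn Px; exists (Ordinal xn).
Qed.

Let leE (x y : 'I_n) : cov_le c x y = le x y.
Proof. by apply: cov_leE; case/and5P: ok. Qed.

Fact check_anti : antisymmetric (@cov_le n c).
Proof.
case/and5P: ok => _ h _ _ _ x y; rewrite !leE => xy.
by have /implyP /(_ xy) /eqP /val_inj := allI y (allI x h).
Qed.

Fact check_meet (x y : 'I_n) : exists m, forall z : 'I_n,
  cov_le c z m = cov_le c z x && cov_le c z y.
Proof.
case/and5P: ok => _ _ h _ _; have [m mP] := hasI (allI y (allI x h)).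
by exists m => z; rewrite !leE; apply/eqP/(allI z mP).
Qed.

Fact check_join (x y : 'I_n) : exists m, forall z : 'I_n,
  cov_le c m z = cov_le c x z && cov_le c y z.
Proof.
case/and5P: ok => _ _ _ h _; have [m mP] := hasI (allI y (allI x h)).
by exists m => z; rewrite !leE; apply/eqP/(allI z mP).
Qed.

Fact check_covE (u v : 'I_n) : cov_rel c u v <->
  [/\ u != v, cov_le c u v & forall w,
      cov_le c u w -> cov_le c w v -> w = u \/ w = v].
Proof.
case/and5P: ok => _ _ _ _ h; have /eqP e := allI v (allI u h).
rewrite /cov_rel e leE; split.
- case/and3P => uv luv a; split => // w; rewrite !leE => uw wv.
  have := allI w a; rewrite uw wv /= => /orP [/eqP|/eqP] /val_inj ->;
    by [left | right].
- case=> uv luv a; apply/and3P; split=> //; apply/allP => w.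
  rewrite mem_iota add0n => /= wn; apply/implyP => /andP [uw wv].
  have [] := a (Ordinal wn); rewrite ?leE // => <-; by rewrite eqxx ?orbT.
Qed.

Definition check_mk : diagram :=
  Diagram check_anti check_meet check_join check_covE.

End Check.

Notation mk_diagram n c := (@check_mk n c isT).

(* ------------------------------------------------------------------------ *)

(* In the lattices with 5 elements 0, a, b, c, 1 the labels are 0, 1, 2, 3, 4;
   in those with 6 elements 0, a, b, c, d, 1 they are 0, 1, 2, 3, 4, 5. *)
Definition M3_cov := [:: (0, 1); (0, 2); (0, 3); (1, 4); (2, 4); (3, 4)]%N.
Definition N5_cov := [:: (0, 1); (1, 3); (3, 4); (0, 2); (2, 4)]%N.
Definition M4_cov :=
  [:: (0, 1); (0, 2); (0, 3); (0, 4); (1, 5); (2, 5); (3, 5); (4, 5)]%N.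
Definition A1_cov :=
  [:: (0, 1); (1, 3); (3, 5); (0, 2); (2, 5); (0, 4); (4, 5)]%N.
Definition A2_cov := [:: (0, 1); (1, 3); (3, 5); (0, 2); (2, 4); (4, 5)]%N.
Definition A3_cov := [:: (0, 1); (1, 3); (3, 4); (4, 5); (0, 2); (2, 5)]%N.
Definition L4_cov :=
  [:: (0, 1); (0, 2); (1, 4); (2, 4); (4, 5); (0, 3); (3, 5)]%N.

Definition M3 := mk_diagram 5 M3_cov.
Definition N5 := mk_diagram 5 N5_cov.
Definition M4 := mk_diagram 6 M4_cov.
Definition A1 := mk_diagram 6 A1_cov.
Definition A2 := mk_diagram 6 A2_cov.
Definition A3 := mk_diagram 6 A3_cov.
Definition L4 := mk_diagram 6 L4_cov.
(* the dual of L4, by reversing the covering relation *)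
Definition L5 := mk_diagram 6 [seq (p.2, p.1) | p <- L4_cov].
(* In B1, ..., B4 the added element is 5; the greatest element of M3 and N5
   is 4 and their least element is 0. *)
Definition B1 := mk_diagram 6 (rcons M3_cov (4, 5)%N).
Definition B2 := mk_diagram 6 ((5, 0)%N :: M3_cov).
Definition B3 := mk_diagram 6 (rcons N5_cov (4, 5)%N).
Definition B4 := mk_diagram 6 ((5, 0)%N :: N5_cov).

(* The eight-element lattice {p_1, ..., p_8}; p_i has label i, less 1. *)
Definition P8 := mk_diagram 8
  [seq (p.1.-1, p.2.-1) | p <- [:: (1, 2); (1, 3); (2, 4); (3, 4); (3, 6);
     (4, 5); (4, 7); (6, 7); (5, 8); (7, 8)]%N].

Definition nondistributive56 : 12.-tuple diagram :=
  [tuple M3; N5; M4; A1; A2; A3; L4; L5; B1; B2; B3; B4].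

(* Main.v *)
Require Import Defs.
From HB Require Import structures.
From mathcomp Require Import all_boot all_order.
From mathcomp Require Import boolp zify.

(** Every median lies between the lower median (x /\ y) \/ (x /\ z) \/ (y /\ z)
and its dual, so it is determined by its values on the triples, up to
permutation, on which these two differ.  Conversely, values chosen on these
triples within the bounds extend to a median as soon as they are monotone
among themselves: comparisons with a forced triple come for free from the
bounds.  OutMed(L) is thus a lattice of short words ordered pointwise.

The values of a term on k triples form an element of the sublattice of L^k
generated by the three words of coordinates.  For well-chosen triples this
sublattice has five or six elements, and finitely many of them exclude every
median that is not inner.

For the classification, the elements of a lattice are numbered along a linear
extension of its order.  The first and last are then its bounds, and the order
is determined by the comparable pairs among the three or four others, which
leaves 2^3 or 2^6 relations to inspect.  The multiset of the sizes of principal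
ideals and filters separates the twelve lattices. *)

Set Implicit Arguments.
Unset Strict Implicit.
Unset Printing Implicit Defensive.

Import Order.TTheory.
Local Open Scope order_scope.

(** * Isomorphisms of lattices and codings by words *)

Section LatticeIso.
Context d (L : latticeType d) d' (M : latticeType d').

(** Meets and joins are determined by the order, and surjectivity of [f] pulls a bound in [M] back
    to a bound in [L]. *)
Lemma order_iso (f : L -> M) :
  bijective f -> (forall x y, (f x <= f y) = (x <= y)) -> lattice_iso L M.
Proof.
move=> [g fK gK] f_le.
have fI x y : f (x `&` y) = f x `&` f y.
  apply/le_anti; rewrite lexI !f_le leIl leIr /=.
  by rewrite -[f x `&` f y]gK f_le lexI -!f_le gK leIl leIr.
have fU x y : f (x `|` y) = f x `|` f y.
  apply/le_anti; rewrite leUx !f_le leUl leUr !andbT.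
  by rewrite -[f x `|` f y]gK f_le leUx -!f_le gK leUl leUr.
have f_homo : {homo f : x y / x <= y} by move=> x y; rewrite f_le.
pose F0 : {omorphism L -> M} := HB.pack f (Order.isOrderMorphism.Build d L d' M f f_homo).
pose F : {lmorphism L -> M} := HB.pack f F0
  (Order.isLatticeMorphism.Build d L d' M F0 fI fU).
by exists F; exists g.
Qed.

Lemma iso_le (f : {lmorphism L -> M}) x y :
  injective f -> (f x <= f y) = (x <= y).
Proof. by move=> f_inj; rewrite !leEmeet -omorphI (inj_eq f_inj). Qed.

Lemma iso_distributive :
  lattice_iso L M -> distributive_lattice L -> distributive_lattice M.
Proof.
case=> f [g fK gK] distL x y z.
by rewrite -[x]gK -[y]gK -[z]gK -!(omorphI, omorphU) distL.
Qed.

End LatticeIso.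

(* Words of numbers serve as computable names of elements: one digit for an
   element of a diagram, a list of values for a monotone map or a median. *)
Definition coded d (L : porderType d) (l : seq (seq nat)) (r : rel (seq nat)) :=
  exists cd : L -> seq nat,
    [/\ forall x, cd x \in l, forall v, v \in l -> exists x, cd x = v
      & forall x y, (x <= y) = r (cd x) (cd y)].

Lemma coded_inj d (L : porderType d) (r : rel (seq nat)) (cd : L -> seq nat) :
  (forall x y, (x <= y) = r (cd x) (cd y)) -> injective cd.
Proof.
by move=> cd_le x y e; apply/le_anti; rewrite !cd_le -e -cd_le lexx.
Qed.

Section Coded.
Context d (L : latticeType d) (l : seq (seq nat)) (r : rel (seq nat)).

Lemma coded_iso d' (M : latticeType d') l' :
  coded L l r -> coded M l' r -> l =i l' -> lattice_iso L M.
Proof.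
move=> [cd [cd_in cd_onto cd_le]] [cd' [cd'_in cd'_onto cd'_le]] ll'.
have /choice [f fE] : forall x, exists y, cd' y = cd x.
  by move=> x; apply: cd'_onto; rewrite -ll'.
have /choice [g gE] : forall y, exists x, cd x = cd' y.
  by move=> y; apply: cd_onto; rewrite ll'.
apply: (@order_iso _ _ _ _ f); last by move=> x y; rewrite cd'_le !fE cd_le.
exists g => x; first by apply: (coded_inj cd_le); rewrite gE fE.
by apply: (coded_inj cd'_le); rewrite fE gE.
Qed.

(** Injectivity of [h] on [l] comes from antisymmetry in [L], as [h] preserves and reflects the
    relation. *)
Lemma coded_map (h : seq nat -> seq nat) r' :
  allrel (fun u v => r u v == r' (h u) (h v)) l l ->
  coded L l r -> coded L (map h l) r'.
Proof.
move=> /allrelP rr' [cd [cd_in cd_onto cd_le]]; exists (h \o cd); split.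
- by move=> x; apply: map_f.
- by move=> _ /mapP [v /cd_onto [x <-] ->]; exists x.
- by move=> x y; rewrite cd_le; apply/eqP/rr'.
Qed.

Lemma coded_bij : uniq l -> coded L l r ->
  exists f : 'I_(size l) -> L, bijective f.
Proof.
move=> l_uniq [cd [cd_in cd_onto cd_le]].
have /choice [f fE] : forall i : 'I_(size l), exists x, cd x = nth [::] l i.
  by move=> i; apply: cd_onto; apply: mem_nth.
have ci x : (index (cd x) l < size l)%N by rewrite index_mem.
exists f; exists (fun x => Ordinal (ci x)) => x.
  by apply: val_inj => /=; rewrite fE index_uniq.
by apply: (coded_inj cd_le); rewrite fE /= nth_index.
Qed.

End Coded.

Lemma coded_prod d (L : latticeType d) d' (M : latticeType d') k l r l' r' :
  coded L l r -> coded M l' r' -> all (fun v => size v == k) l ->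
  coded (L *p M)%type [seq u ++ v | u <- l, v <- l']
    (fun u v => r (take k u) (take k v) && r' (drop k u) (drop k v)).
Proof.
move=> [cd [cd_in cd_onto cd_le]] [cd' [cd'_in cd'_onto cd'_le]] /allP lk.
exists (fun x => cd x.1 ++ cd' x.2); split.
- by move=> x; apply: allpairs_f.
- by move=> _ /allpairsP [[u v] [/cd_onto [x <-] /cd'_onto [y <-] ->]]; exists (x, y).
- move=> x y; have sz z : size (cd z) = k by apply/eqP/lk.
  by rewrite leEprod cd_le cd'_le !take_size_cat ?drop_size_cat.
Qed.

(** * Tabulated lattices, their powers and monotone maps *)

Definition words (n k : nat) : seq (seq nat) :=
  iter k (fun l => [seq x :: v | x <- iota 0 n, v <- l]) [:: [::]].

Lemma mem_words n k v : (v \in words n k) = (size v == k) && all (fun x => x < n)%N v.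
Proof.
elim: k v => [|k IHk] v /=; first by case: v.
apply/allpairsP/idP => [[[x w] [/=]]|].
  by rewrite mem_iota IHk => xn /andP [/eqP sw wn] ->; rewrite /= sw eqxx wn andbT.
case: v => // x w /=; rewrite eqSS => /andP [sw /andP [xn wn]].
by exists (x, w); rewrite /= mem_iota IHk sw wn.
Qed.

Lemma coded_ord n : coded 'I_n (words n 1) (all2 leq).
Proof.
exists (fun i : 'I_n => [:: val i]); split=> [i|v|i j].
- by rewrite mem_words /= ltn_ord.
- by rewrite mem_words; case: v => [|x []] //= /andP [xn _]; exists (Ordinal xn).
- by rewrite /= andbT.
Qed.

(** Unlike in [coded], both directions of the numbering are data, so that operations on [L] become
    functions on numbers. *)
Record tabulated d (L : porderType d) (n : nat) (r : rel nat) := Tabulated {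
  tel : nat -> L;
  tcd : L -> nat;
  tcdK : cancel tcd tel;
  telK : forall k, (k < n)%N -> tcd (tel k) = k;
  tcd_lt : forall x, (tcd x < n)%N;
  tcd_le : forall x y, (x <= y) = r (tcd x) (tcd y) }.

Section Tabulated.
Context d (L : latticeType d) (n : nat) (r : rel nat) (T : tabulated L n r).
Local Notation el := (tel T).
Local Notation cd := (tcd T).

Lemma tcd_inj : injective cd. Proof. exact: can_inj (tcdK T). Qed.

Lemma tabulated_le i j : (i < n)%N -> (j < n)%N -> (el i <= el j) = r i j.
Proof. by move=> i_n j_n; rewrite (tcd_le T) !telK. Qed.

Lemma tabulated_coded : coded L (words n 1) (all2 r).
Proof.
exists (fun x => [:: cd x]); split=> [x|v|x y].
- by rewrite mem_words /= tcd_lt.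
- rewrite mem_words; case: v => [|x []] //= /andP [xn _].
  by exists (el x); rewrite telK.
- by rewrite /= andbT -tcd_le.
Qed.

Lemma tabulated_pow k : coded ('I_k -> L) (words n k) (all2 r).
Proof.
exists (fun f => [seq cd (f i) | i <- enum 'I_k]); split.
- move=> f; rewrite mem_words size_map size_enum_ord eqxx /=.
  by apply/allP => _ /mapP [i _ ->]; apply: tcd_lt.
- move=> v; rewrite mem_words => /andP [/eqP sv /allP vn].
  exists (fun i => el (nth 0 v i)).
  apply: (@eq_from_nth _ 0) => [|i]; rewrite size_map size_enum_ord ?sv // => ik.
  rewrite (nth_map (Ordinal ik)) ?size_enum_ord // telK nth_enum_ord //.
  by apply: vn; apply: mem_nth; rewrite sv.
- move=> f g; rewrite all2E !size_map eqxx /= zip_map all_map.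
  apply/lefP/allP => /= [fg i _|fg i]; first by rewrite -tcd_le.
  by rewrite (tcd_le T); apply: fg; rewrite mem_enum.
Qed.

Lemma tabulated_MonMaps2 :
  coded (MonMaps 'I_2 L) [seq v <- words n 2 | r (nth 0 v 0) (nth 0 v 1)] (all2 r).
Proof.
pose i1 : 'I_2 := Ordinal (isT : (1 < 2)%N).
have ord2 (i : 'I_2) : i = ord0 \/ i = i1.
  by case: i => [[|[|]]] // ?; [left|right]; apply: val_inj.
exists (fun f : MonMaps 'I_2 L => [:: cd (f ord0); cd (f i1)]); split.
- move=> f; rewrite mem_filter mem_words /= !tcd_lt -tcd_le !andbT.
  have /asboolP := valP f => /= h; exact: h.
- move=> v; rewrite mem_filter mem_words.
  rewrite andbC; case: v => [|x [|y []]] //= /andP [/and3P [xn yn _] xy].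
  have m : `[< {homo (fun i : 'I_2 => if i == ord0 then el x else el y)
                  : i j / i <= j} >].
    apply/asboolP => i j.
    by case: (ord2 i) => ->; case: (ord2 j) => ->; rewrite //= ?lexx // tabulated_le.
  by exists (MkMonMaps m); rewrite /= !telK.
- move=> f g; rewrite /= andbT -!tcd_le; apply/idP/idP.
    by move=> /lefP fg; rewrite !fg.
  by case/andP => h0 h1; apply/lefP => i; case: (ord2 i) => ->.
Qed.

End Tabulated.

(** * Computed meets and joins *)

Section CodedOperations.
Variables (n : nat) (r : rel nat).

(** The universal property is searched for; if no meet exists the result is [n], which [lattice_rel]
    detects. *)
Definition cmeet (x y : nat) : nat :=
  find (fun m => all (fun z => r z m == r z x && r z y) (iota 0 n)) (iota 0 n).

Lemma cmeetE d (L : latticeType d) (T : tabulated L n r) (x y : L) :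
  tcd T (x `&` y) = cmeet (tcd T x) (tcd T y).
Proof.
rewrite /cmeet; set P := fun m => all _ _.
have PP m : (m < n)%N -> P m -> m = tcd T (x `&` y).
  move=> mn /allP Pm; rewrite -(telK T mn); congr tcd; apply/le_anti.
  have Pl (z : L) : (z <= tel T m) = (z <= x `&` y).
    rewrite lexI !(tcd_le T) telK //.
    by apply/eqP/Pm; rewrite mem_iota tcd_lt.
  by rewrite -Pl lexx Pl lexx.
have hP : has P (iota 0 n).
  apply/hasP; exists (tcd T (x `&` y)); first by rewrite mem_iota tcd_lt.
  apply/allP => z; rewrite mem_iota => /= zn.
  by rewrite -(telK T zn) -!tcd_le lexI.
have fn : (find P (iota 0 n) < n)%N by rewrite -[ltnRHS](size_iota 0) -has_find.
by apply/esym/PP => //; have := nth_find 0 hP; rewrite nth_iota.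
Qed.

End CodedOperations.

Definition tabulated_dual d (L : porderType d) n r (T : tabulated L n r) :
  tabulated L^d n (fun x y => r y x) :=
  @Tabulated _ L^d n (fun x y => r y x) (tel T) (tcd T) (tcdK T) (telK T)
    (tcd_lt T) (fun x y => tcd_le T y x).

Definition cjoin n (r : rel nat) := cmeet n (fun x y => r y x).

Lemma cjoinE n r d (L : latticeType d) (T : tabulated L n r) (x y : L) :
  tcd T (x `|` y) = cjoin n r (tcd T x) (tcd T y).
Proof. exact: (cmeetE (tabulated_dual T)). Qed.

(** Tables let later computations look meets and joins up instead of searching again. *)
Definition tabulate A n (f : nat -> nat -> A) : seq (seq A) :=
  [seq [seq f x y | y <- iota 0 n] | x <- iota 0 n].
Definition look A (a : A) (t : seq (seq A)) (x y : nat) : A := nth a (nth [::] t x) y.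

Lemma lookE A (a : A) n f x y :
  (x < n)%N -> (y < n)%N -> look a (tabulate n f) x y = f x y.
Proof.
by move=> xn yn; rewrite /look (nth_map 0) ?size_iota // (nth_map 0) ?size_iota // !nth_iota.
Qed.

Definition prods (ls : seq (seq nat)) : seq (seq nat) :=
  foldr (fun l acc => [seq x :: v | x <- l, v <- acc]) [:: [::]] ls.

Lemma mem_prods ls v : (v \in prods ls) = all2 (fun x (l : seq nat) => x \in l) v ls.
Proof.
elim: ls v => [|l ls IHl] v /=; first by case: v.
apply/allpairsP/idP => [[[x w] [/= xl]]|]; first by rewrite IHl => wl -> /=; rewrite xl.
by case: v => // x w /= /andP [xl wl]; exists (x, w); rewrite IHl.
Qed.

(** * Medians between the lower and the upper median *)

Definition lower_term : lterm :=
  TJoin (TJoin (TMeet TX TY) (TMeet TX TZ)) (TMeet TY TZ).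
Definition upper_term : lterm :=
  TMeet (TMeet (TJoin TX TY) (TJoin TX TZ)) (TJoin TY TZ).

Section Medians.
Context d (L : latticeType d).
Implicit Types (x y z : L) (f : L * L * L -> L).

Definition lower t := let: (x, y, z) := t in lterm_eval x y z lower_term : L.
Definition upper t := let: (x, y, z) := t in lterm_eval x y z upper_term : L.

Lemma symmetric3_swaps f :
  (forall x y z, f (x, z, y) = f (x, y, z)) ->
  (forall x y z, f (y, x, z) = f (x, y, z)) -> symmetric3 f.
Proof.
move=> s23 s12 x y z; split; [exact: s23|exact: s12|..].
- by rewrite s23 s12.
- by rewrite s12 s23.
- by rewrite s23 s12 s23.
Qed.

Lemma lower_sym : symmetric3 lower.
Proof.
apply: symmetric3_swaps => x y z /=.
  by rewrite [z `&` y]meetC [x `&` z `|` _]joinC.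
by rewrite [y `&` x]meetC joinAC.
Qed.

Lemma upper_sym : symmetric3 upper.
Proof.
apply: symmetric3_swaps => x y z /=.
  by rewrite [z `|` y]joinC [(x `|` z) `&` _]meetC.
by rewrite [y `|` x]joinC meetAC.
Qed.

Lemma lower_mono : monotone3 lower.
Proof. by move=> *; rewrite /= !leU2 // leI2. Qed.

Lemma upper_mono : monotone3 upper.
Proof. by move=> *; rewrite /= !leI2 // leU2. Qed.

(** Any two of the three pairs of variables share a variable, which lies above the meet of the one
    and below the join of the other. *)
Lemma lower_le_upper t : lower t <= upper t.
Proof.
case: t => [[x y] z] /=; rewrite !(leUx, lexI).
by repeat (apply/andP; split); first
  [ by rewrite leIxl // leUl | by rewrite leIxl // leUr
  | by rewrite leIxr // leUl | by rewrite leIxr // leUr ].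
Qed.

(** By majority x /\ y is the value of [f] at (x /\ y, x /\ y, z), and by monotonicity this is at
    most its value at (x, y, z). *)
Lemma lower_median_le f t : median f -> lower t <= f t.
Proof.
case: t => [[x y] z] [_ mf jf] /=; rewrite !leUx.
have [<- _ _] := jf (x `&` y) z; have [_ <- _] := jf (x `&` z) y.
have [_ _ <-] := jf (y `&` z) x.
by rewrite !mf ?leIl ?leIr.
Qed.

Lemma median_le_upper f t : median f -> f t <= upper t.
Proof.
case: t => [[x y] z] [_ mf jf] /=; rewrite !lexI.
have [<- _ _] := jf (x `|` y) z; have [_ <- _] := jf (x `|` z) y.
have [_ _ <-] := jf (y `|` z) x.
by rewrite !mf ?leUl ?leUr.
Qed.

(** Majority is automatic: by absorption both bounds equal x at (x, x, y). *)
Lemma median_between f : symmetric3 f -> monotone3 f ->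
  (forall t, lower t <= f t <= upper t) -> median f.
Proof.
move=> sf mf bf; split=> // x y.
have e : f (x, x, y) = x.
  apply/le_anti; have := bf (x, x, y).
  rewrite /= meetxx joinxx => /andP [h1 h2]; apply/andP; split.
    by apply: le_trans h2 _; rewrite leIxl // leIl.
  by apply: le_trans h1; rewrite -joinA leUl.
by have [e1 _ _ e4 _] := sf x x y; rewrite e1 e4 e.
Qed.

End Medians.

(** * Medians as words of values on the free triples *)

Definition triple := (nat * nat * nat)%type.

Definition perms3 (t : triple) : seq triple :=
  let: (x, y, z) := t in
  [:: (x, y, z); (x, z, y); (y, x, z); (y, z, x); (z, x, y); (z, y, x)].

Lemma perms3_swap23 x y z : perms3 (x, z, y) =i perms3 (x, y, z).
Proof. by move=> t; rewrite !inE; do 6!case: (t == _). Qed.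

Lemma perms3_swap12 x y z : perms3 (y, x, z) =i perms3 (x, y, z).
Proof. by move=> t; rewrite !inE; do 6!case: (t == _). Qed.

Lemma mem_perms3 t : t \in perms3 t.
Proof. by case: t => [[x y] z]; rewrite inE eqxx. Qed.

Lemma perms3_eq s t : s \in perms3 t -> perms3 s =i perms3 t.
Proof.
case: t => [[x y] z]; rewrite !inE => h u.
by case/or4P: h => [/eqP->|/eqP->|/eqP->|/or3P[]/eqP->]; rewrite !inE //; do 6!case: (u == _).
Qed.

Section CodedMedians.
Variables (n : nat) (r : rel nat) (m j : nat -> nat -> nat).

Fixpoint ceval (x y z : nat) (t : lterm) : nat :=
  match t with
  | TX => x
  | TY => y
  | TZ => z
  | TMeet s t => m (ceval x y z s) (ceval x y z t)
  | TJoin s t => j (ceval x y z s) (ceval x y z t)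
  end.

Definition cterm (t : lterm) (s : triple) : nat :=
  let: (x, y, z) := s in ceval x y z t.

Definition le3 (s t : triple) : bool :=
  [&& r s.1.1 t.1.1, r s.1.2 t.1.2 & r s.2 t.2].

Definition triples : seq triple :=
  [seq (xy, z) | xy <- [seq (x, y) | x <- iota 0 n, y <- iota 0 n], z <- iota 0 n].

(* The triples, one from each orbit under permutations, on which a median is
   not forced. *)
Variable F : seq triple.

(** The position in [F] of the representative of the orbit of [t]; it is [size F] when the orbit has
    none. *)
Definition key (t : triple) : nat := find (mem (perms3 t)) F.

(** The second conjunct says that the entries of [F] lie in distinct orbits, the third that every
    orbit without a representative is forced. *)
Definition check_free : bool :=
  [&& all (mem triples) F, [seq key t | t <- F] == iota 0 (size F)
    & all (fun t => (key t < size F)%N || (cterm lower_term t == cterm upper_term t)) triples].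

(** By symmetry the value at the first triple is bounded by that at the second as soon as some
    permutation of the second dominates the first. *)
Definition constraints : seq (nat * nat) :=
  [seq p <- [seq (a, b) | a <- iota 0 (size F), b <- iota 0 (size F)] |
     has (le3 (nth (0, 0, 0) F p.1)) (perms3 (nth (0, 0, 0) F p.2))].

Definition cmedians : seq (seq nat) :=
  let c := constraints in
  [seq v <- prods [seq [seq a <- iota 0 n | r (cterm lower_term t) a && r a (cterm upper_term t)]
                  | t <- F]
  | all (fun p => r (nth 0 v p.1) (nth 0 v p.2)) c].

Definition cdecode (v : seq nat) (t : triple) : nat :=
  let k := key t in if (k < size F)%N then nth 0 v k else cterm lower_term t.

Context d (L : latticeType d) (T : tabulated L n r).
Hypothesis mE : forall x y, tcd T (x `&` y) = m (tcd T x) (tcd T y).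
Hypothesis jE : forall x y, tcd T (x `|` y) = j (tcd T x) (tcd T y).
Hypothesis freeP : check_free.

Definition cd3 (t : L * L * L) : triple := (tcd T t.1.1, tcd T t.1.2, tcd T t.2).
Definition el3 (t : triple) : L * L * L := (tel T t.1.1, tel T t.1.2, tel T t.2).

Lemma cd3K : cancel cd3 el3.
Proof. by case=> [[x y] z]; rewrite /el3 /= !tcdK. Qed.

Lemma mem_triples t : (t \in triples) = [&& t.1.1 < n, t.1.2 < n & t.2 < n]%N.
Proof.
case: t => [[x y] z]; apply/allpairsP/and3P.
  case=> [[xy w]] [/allpairsP [[u v] /= [+ + ->]] + [-> -> ->]] /=.
  by rewrite !mem_iota.
move=> /= [xn yn zn]; exists ((x, y), z); rewrite mem_iota; split=> //.
by apply/allpairsP; exists (x, y); rewrite !mem_iota.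
Qed.

Lemma cd3_triples t : cd3 t \in triples.
Proof. by rewrite mem_triples !tcd_lt. Qed.

Lemma el3K t : t \in triples -> cd3 (el3 t) = t.
Proof.
by rewrite mem_triples; case: t => [[x y] z] /= /and3P [? ? ?]; rewrite /cd3 /= !telK.
Qed.

Lemma cevalE x y z t :
  tcd T (lterm_eval x y z t) = ceval (tcd T x) (tcd T y) (tcd T z) t.
Proof.
by elim: t => [|||s IHs t IHt|s IHs t IHt] //=; rewrite ?mE ?jE IHs IHt.
Qed.

Lemma lowerE t : tcd T (lower t) = cterm lower_term (cd3 t).
Proof. by case: t => [[x y] z]; rewrite /lower cevalE. Qed.

Lemma upperE t : tcd T (upper t) = cterm upper_term (cd3 t).
Proof. by case: t => [[x y] z]; rewrite /upper cevalE. Qed.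

Lemma free_in k : (k < size F)%N -> nth (0, 0, 0) F k \in triples.
Proof. by case/and3P: freeP => /allP h _ _ kF; apply/h/mem_nth. Qed.

Lemma key_nth k : (k < size F)%N -> key (nth (0, 0, 0) F k) = k.
Proof.
case/and3P: freeP => _ /eqP h _ kF.
by rewrite -(nth_map _ 0) // h nth_iota.
Qed.

Lemma key_perm t : (key t < size F)%N -> nth (0, 0, 0) F (key t) \in perms3 t.
Proof. by rewrite -has_find => h; have := nth_find (0, 0, 0) h. Qed.

Lemma eq_key s t : perms3 s =i perms3 t -> key s = key t.
Proof. by move=> st; apply: eq_find => u; rewrite !inE st. Qed.

Lemma not_free t : (key (cd3 t) < size F)%N = false -> lower t = upper t.
Proof.
move=> kF; case/and3P: freeP => _ _ /allP /(_ _ (cd3_triples t)).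
by rewrite kF orFb -lowerE -upperE => /eqP /tcd_inj.
Qed.

Lemma symmetric_perms3 (f : L * L * L -> L) s t :
  symmetric3 f -> cd3 s \in perms3 (cd3 t) -> f s = f t.
Proof.
move=> sf; rewrite -{2}[s]cd3K; move: (cd3 s) => u.
case: t => [[x y] z]; have [f1 f2 f3 f4 f5] := sf x y z; rewrite !inE.
by case/or4P => [/eqP->|/eqP->|/eqP->|/or3P[]/eqP->]; rewrite /el3 /= !tcdK.
Qed.

Lemma free_value (f : L * L * L -> L) t : symmetric3 f ->
  (key (cd3 t) < size F)%N -> f (el3 (nth (0, 0, 0) F (key (cd3 t)))) = f t.
Proof.
move=> sf kF; apply: symmetric_perms3 => //.
by rewrite el3K ?key_perm // free_in.
Qed.

Definition code (f : L * L * L -> L) : seq nat := [seq tcd T (f (el3 t)) | t <- F].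

Definition decode (v : seq nat) (t : L * L * L) : L := tel T (cdecode v (cd3 t)).

Lemma code_cmedians f : median f -> code f \in cmedians.
Proof.
move=> mf; have [sf hf _] := mf; rewrite mem_filter mem_prods; apply/andP; split.
- apply/allP => -[a b]; rewrite mem_filter => /andP [/hasP [t tb lat] /allpairsP].
  case=> [[a' b']] [/=]; rewrite !mem_iota => aF bF [? ?]; subst a' b'.
  rewrite !(nth_map (0, 0, 0)) // -tcd_le.
  have tn : t \in triples.
    have := free_in bF; move: tb; case: (nth _ F b) => [[x y] z].
    rewrite !inE !mem_triples /= => h /and3P [xn yn zn].
    by case/or4P: h => [/eqP->|/eqP->|/eqP->|/or3P[]/eqP->]; rewrite /= xn yn zn.
  have <- : f (el3 t) = f (el3 (nth (0, 0, 0) F b)).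
    by apply: symmetric_perms3; rewrite ?el3K ?free_in.
  move: lat (free_in aF) tn; rewrite !mem_triples.
  by case/and3P=> h1 h2 h3 /and3P [? ? ?] /and3P [? ? ?]; apply: hf; rewrite tabulated_le.
- have : all (mem triples) F by case/and3P: freeP.
  rewrite /code; elim: F => //= t F' IH /andP [tn F'n]; rewrite IH // andbT.
  rewrite mem_filter mem_iota /= tcd_lt andbT.
  by rewrite -{1 4}(el3K tn) -lowerE -upperE -!tcd_le lower_median_le ?median_le_upper.
Qed.

Lemma cdecode_code f t : median f -> tcd T (f t) = cdecode (code f) (cd3 t).
Proof.
move=> mf; have [sf _ _] := mf; rewrite /cdecode; case: ifPn => [kF|/negbTE kF].
  by rewrite (nth_map (0, 0, 0)) // free_value.
rewrite -lowerE; congr tcd; apply/le_anti.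
by rewrite {1}(not_free kF) median_le_upper ?lower_median_le.
Qed.

(** At a forced triple the comparison holds anyway: f t <= upper t = lower t <= g t. *)
Lemma code_le f g : median f -> median g ->
  (forall t, f t <= g t) <-> all2 r (code f) (code g).
Proof.
move=> mf mg; have [sf _ _] := mf; have [sg _ _] := mg.
rewrite all2E !size_map eqxx zip_map all_map; split=> [fg|/allP fg t].
  by apply/allP => t _ /=; rewrite -tcd_le.
have [kF|kF] := boolP (key (cd3 t) < size F)%N.
  rewrite -(free_value sf kF) -(free_value sg kF) (tcd_le T).
  by apply: (fg (nth (0, 0, 0) F _)); apply: mem_nth.
apply: (@le_trans _ _ (upper t)); first exact: median_le_upper.
by rewrite -not_free ?lower_median_le //; apply/negbTE.
Qed.

Section Decode.
Variables (v : seq nat) (v_med : v \in cmedians).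

Lemma cmedians_nth k : (k < size F)%N ->
  [/\ (nth 0 v k < n)%N, r (cterm lower_term (nth (0, 0, 0) F k)) (nth 0 v k)
    & r (nth 0 v k) (cterm upper_term (nth (0, 0, 0) F k))].
Proof.
move: v_med; rewrite mem_filter mem_prods all2E => /and3P [_ sv] h kF.
rewrite size_map in sv; move/(all_nthP (0, [::]))/(_ k): h.
rewrite size_zip size_map (eqP sv) minnn => /(_ kF).
rewrite nth_zip ?size_map ?(eqP sv) //= (nth_map (0, 0, 0)) //.
by rewrite mem_filter mem_iota => /andP [/andP [h1 h2] h3].
Qed.

Lemma decode_free t : (key (cd3 t) < size F)%N ->
  tcd T (decode v t) = nth 0 v (key (cd3 t)).
Proof. by move=> kF; rewrite /decode /cdecode kF telK //; case: (cmedians_nth kF). Qed.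

Lemma decode_nfree t : (key (cd3 t) < size F)%N = false -> decode v t = lower t.
Proof. by move=> kF; rewrite /decode /cdecode kF -lowerE tcdK. Qed.

Lemma decode_between t : lower t <= decode v t <= upper t.
Proof.
have [kF|/negbTE kF] := boolP (key (cd3 t) < size F)%N; last first.
  by rewrite decode_nfree // lexx lower_le_upper.
rewrite -(free_value (@lower_sym _ L) kF) -(free_value (@upper_sym _ L) kF).
rewrite !(tcd_le T) decode_free // lowerE upperE el3K ?free_in //.
by case: (cmedians_nth kF) => _ -> ->.
Qed.

Lemma decode_sym : symmetric3 (decode v).
Proof.
have H s t : lower s = lower t -> perms3 (cd3 s) =i perms3 (cd3 t) ->
    decode v s = decode v t.
  move=> l_st /eq_key k_st; rewrite /decode /cdecode k_st.
  by rewrite -!lowerE l_st.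
apply: symmetric3_swaps => x y z; apply: H.
- by have [] := lower_sym x y z.
- exact: perms3_swap23.
- by have [] := lower_sym x y z.
- exact: perms3_swap12.
Qed.

(** The representative of the orbit of [s] is a permutation of [s]; the same permutation of [t]
    dominates it. *)
Lemma constraint_mem (s t : L * L * L) :
  (key (cd3 s) < size F)%N -> (key (cd3 t) < size F)%N ->
  le3 (cd3 s) (cd3 t) -> (key (cd3 s), key (cd3 t)) \in constraints.
Proof.
move=> ks kt st; rewrite mem_filter; apply/andP; split; last first.
  by apply/allpairsP; exists (key (cd3 s), key (cd3 t)); rewrite !mem_iota.
have sP := key_perm ks; have tP := key_perm kt.
rewrite /= (eq_has_r (perms3_eq tP)); move: st sP.
move: (cd3 s) (cd3 t) (nth _ _ _) => [[x y] z] [[x' y'] z'] u /and3P /= [hx hy hz].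
rewrite !inE /le3; case/or4P => [/eqP->|/eqP->|/eqP->|/or3P[]/eqP->];
  by rewrite /= hx hy hz ?orbT.
Qed.

Lemma decode_mono : monotone3 (decode v).
Proof.
move=> x x' y y' z z' hx hy hz; set s := (x, y, z); set t := (x', y', z').
(* If [t] is forced, the value at [s] is at most upper s <= upper t = lower t; a forced [s] is
   treated dually. *)
have [kt|/negbTE kt] := boolP (key (cd3 t) < size F)%N; last first.
  have /andP [_ h] := decode_between s; apply: le_trans h _.
  by rewrite [leRHS]decode_nfree // not_free // upper_mono.
have [ks|/negbTE ks] := boolP (key (cd3 s) < size F)%N; last first.
  have /andP [h _] := decode_between t; apply: le_trans h.
  by rewrite [leLHS]decode_nfree // lower_mono.
rewrite (tcd_le T) !decode_free //.
move: v_med; rewrite mem_filter => /andP [/allP h _].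
by apply: (h (_, _)); apply: constraint_mem; rewrite // /le3 -!tcd_le hx hy hz.
Qed.

Lemma decode_median : median (decode v).
Proof.
exact: median_between decode_sym decode_mono decode_between.
Qed.

Lemma decodeK : code (decode v) = v.
Proof.
have sv : size v = size F.
  by move: v_med; rewrite mem_filter mem_prods all2E size_map => /and3P [_ /eqP].
apply: (@eq_from_nth _ 0) => [|k]; rewrite size_map ?sv // => kF.
by rewrite (nth_map (0, 0, 0)) // decode_free el3K ?free_in ?key_nth.
Qed.

End Decode.

Lemma coded_OutMed : coded (OutMed L) cmedians (all2 r).
Proof.
exists (fun f : OutMed L => code f); split.
- by move=> f; apply: code_cmedians; have /asboolP := valP f.
- move=> v v_med; have /asboolP mv := decode_median v_med.
  by exists (MkOutMed mv); rewrite /= decodeK.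
- move=> f g; have /asboolP mf := valP f; have /asboolP mg := valP g.
  by apply/lefP/idP => fg; apply/(code_le mf mg).
Qed.

(** * Term functions and generated sublattices *)

Definition pointwise (o : nat -> nat -> nat) (u v : seq nat) : seq nat :=
  [seq o p.1 p.2 | p <- zip u v].

(** Nothing is proved about this closure: [subalgebra] checks afterwards that the given number of
    rounds was enough. *)
Definition generate (k : nat) (ts : seq triple) : seq (seq nat) :=
  iter k (fun S => undup (S ++ [seq pointwise m u v | u <- S, v <- S]
                            ++ [seq pointwise j u v | u <- S, v <- S]))
    [:: [seq t.1.1 | t <- ts]; [seq t.1.2 | t <- ts]; [seq t.2 | t <- ts]].

Definition subalgebra (ts : seq triple) (S : seq (seq nat)) : bool :=
  [&& [seq t.1.1 | t <- ts] \in S, [seq t.1.2 | t <- ts] \in S, [seq t.2 | t <- ts] \in S,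
      all (mem triples) ts &
      allrel (fun u v => (pointwise m u v \in S) && (pointwise j u v \in S)) S S].

(** The values of a term arise from the three coordinate words by pointwise operations, under which
    [S] is closed. *)
Lemma subalgebraP ts S t : subalgebra ts S -> [seq cterm t s | s <- ts] \in S.
Proof.
case/and5P => h1 h2 h3 _ /allrelP h; elim: t => [|||s hs t ht|s hs t ht].
- by congr (_ \in S): h1; apply: eq_map => [[[]]].
- by congr (_ \in S): h2; apply: eq_map => [[[]]].
- by congr (_ \in S): h3; apply: eq_map => [[[]]].
- have /andP [hm _] := h _ _ hs ht; congr (_ \in S): hm.
  by rewrite /pointwise zip_map -map_comp; apply: eq_map => [[[]]].
- have /andP [_ hj] := h _ _ hs ht; congr (_ \in S): hj.
  by rewrite /pointwise zip_map -map_comp; apply: eq_map => [[[]]].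
Qed.

(* The sublattices generated by the lists in [tss] exclude every median outside
   [I]; the terms realize those in [I]. *)
Definition check_inner (tss : seq (seq triple)) (terms : seq lterm) (I : seq (seq nat)) : bool :=
  let Ss := [seq (ts, generate 2 ts) | ts <- tss] in
  [&& all (fun p => subalgebra p.1 p.2) Ss,
      all (fun v => (v \in I) ||
        has (fun p => [seq cdecode v t | t <- p.1] \notin p.2) Ss) cmedians
    & all (fun v => (v \in cmedians) &&
        has (fun t => all (fun s => cdecode v s == cterm t s) triples) terms) I].

Lemma coded_InnMed tss terms I : check_inner tss terms I -> coded (InnMed L) I (all2 r).
Proof.
case/and3P => /allP hS /allP hout /allP hin; have [cd [_ _ _]] := coded_OutMed.
exists (fun f : InnMed L => code f); split.
- move=> f; have /asboolP mf := valP (val f); have /asboolP [t tE] := valP f.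
  have := hout _ (code_cmedians mf).
  case/orP => // /hasP [[ts S] tsS] /= /negP []; have sub := hS _ tsS.
  have -> : [seq cdecode (code f) s | s <- ts] = [seq cterm t s | s <- ts].
    case/and5P: sub => _ _ _ /allP tsn _; apply/eq_in_map => -[[x y] z] /tsn xyz.
    have e := el3K xyz; rewrite -{1}e -cdecode_code // tE cevalE.
    by case: e => -> -> ->.
  exact: subalgebraP.
- move=> v /hin /andP [v_med /(has_nthP TX) [i _ /allP tE]].
  have /asboolP mv := decode_median v_med.
  have tf : `[< term_function (MkOutMed mv) >].
    apply/asboolP; exists (nth TX terms i) => x y z /=; apply: (@tcd_inj _ _ _ _ T).
    rewrite cevalE /decode (eqP (tE _ (cd3_triples _))) /= -cevalE.
    by rewrite tcdK.
  by exists (MkInnMed tf); rewrite /= decodeK.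
- move=> f g; have /asboolP mf := valP (val f); have /asboolP mg := valP (val g).
  by apply/lefP/idP => fg; apply/(code_le mf mg).
Qed.

End CodedMedians.

(** * Tests for isomorphism and distributivity, and an isomorphism invariant *)

Definition iso_check (l : seq (seq nat)) (r : rel (seq nat)) (l' : seq (seq nat))
    (r' : rel (seq nat)) (h : seq nat -> seq nat) : bool :=
  [&& allrel (fun u v => r u v == r' (h u) (h v)) l l, all (mem l') (map h l)
    & all (mem (map h l)) l'].

Lemma iso_checkP d (L : latticeType d) d' (M : latticeType d') l r l' r' h :
  coded L l r -> coded M l' r' -> iso_check l r l' r' h -> lattice_iso L M.
Proof.
move=> cL cM /and3P [hr /allP h1 /allP h2].
by apply: coded_iso (coded_map hr cL) cM _ => v; apply/idP/idP; [apply: h1|apply: h2].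
Qed.

Section Distributivity.
Variables (n : nat) (r : rel nat).

Definition cdistributive : bool :=
  all (fun x => all (fun y => all (fun z =>
    cmeet n r (cjoin n r x y) z == cjoin n r (cmeet n r x z) (cmeet n r y z))
  (iota 0 n)) (iota 0 n)) (iota 0 n).

Lemma cdistributiveP d (L : latticeType d) (T : tabulated L n r) :
  distributive_lattice L <-> cdistributive.
Proof.
have E (x y z : L) : ((x `|` y) `&` z == (x `&` z) `|` (y `&` z)) =
    (cmeet n r (cjoin n r (tcd T x) (tcd T y)) (tcd T z) ==
     cjoin n r (cmeet n r (tcd T x) (tcd T z)) (cmeet n r (tcd T y) (tcd T z))).
  by rewrite -(inj_eq (@tcd_inj _ _ _ _ T)) !(cmeetE, cjoinE).
split=> [dL|h x y z].
- apply/allP => i; rewrite mem_iota => /= iN; apply/allP => k; rewrite mem_iota => /= kN.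
  apply/allP => l; rewrite mem_iota => /= lN.
  by rewrite -(telK T iN) -(telK T kN) -(telK T lN) -E dL.
- apply/eqP; rewrite E; have mi u : tcd T u \in iota 0 n by rewrite mem_iota tcd_lt.
  by move: h => /allP /(_ _ (mi x)) /allP /(_ _ (mi y)) /allP /(_ _ (mi z)).
Qed.

End Distributivity.

Definition degrees n (r : rel nat) : seq (nat * nat) :=
  [seq (count (r^~ k) (iota 0 n), count (r k) (iota 0 n)) | k <- iota 0 n].

Lemma iso_degrees d (L : latticeType d) d' (M : latticeType d') n r n' r' :
  tabulated L n r -> tabulated M n' r' -> lattice_iso L M ->
  perm_eq (degrees n r) (degrees n' r').
Proof.
move=> T T' [f [g fK gK]]; pose p k := tcd T' (f (tel T k)).
have pK k : (k < n)%N -> tcd T (g (tel T' (p k))) = k.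
  by move=> kn; rewrite /p tcdK fK telK.
have rp k l : (k < n)%N -> (l < n)%N -> r' (p k) (p l) = r k l.
  move=> kn ln; rewrite -tcd_le iso_le ?tabulated_le //; exact: can_inj fK.
(* [p] hits every number below [n'] exactly once, so counts over [iota 0 n'] can be taken over its
   image. *)
have ps : perm_eq (map p (iota 0 n)) (iota 0 n').
  apply: uniq_perm; rewrite ?iota_uniq //.
    rewrite map_inj_in_uniq ?iota_uniq // => k l.
    by rewrite !mem_iota => /= kn ln e; rewrite -(pK k) // e pK.
  move=> k; rewrite mem_iota; apply/mapP/idP => [[l _ ->]|/= kn'].
    exact: tcd_lt.
  exists (tcd T (g (tel T' k))); first by rewrite mem_iota tcd_lt.
  by rewrite /p tcdK gK telK.
pose D k := (count (r'^~ k) (iota 0 n'), count (r' k) (iota 0 n')).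
have -> : degrees n r = [seq D k | k <- map p (iota 0 n)]; last exact: perm_map.
rewrite -map_comp; apply/eq_in_map => k; rewrite mem_iota => /= kn.
by congr (_, _); rewrite -(permP ps) count_map; apply: eq_in_count => l;
  rewrite mem_iota => /= ln; rewrite /= rp.
Qed.

Lemma tabulated_card (n : nat) r d (L : finLatticeType d) : tabulated L n r -> #|L| = n.
Proof.
move=> T; rewrite -[RHS]card_ord.
apply: (@bij_eq_card _ _ (fun x => Ordinal (tcd_lt T x))).
exists (fun i : 'I_n => tel T i) => [x|i]; first by rewrite /= tcdK.
by apply: val_inj; rewrite /= telK.
Qed.

(** * Natural labellings of finite lattices *)

Fixpoint subseqs (A : Type) (s : seq A) : seq (seq A) :=
  if s is x :: s' then subseqs s' ++ map (cons x) (subseqs s') else [:: [::]].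

Lemma filter_subseqs (A : eqType) (a : pred A) s : filter a s \in subseqs s.
Proof.
elim: s => //= x s IH; rewrite mem_cat; case: (a x); last by rewrite IH.
by rewrite map_f ?orbT.
Qed.

Definition inner_pairs n : seq (nat * nat) :=
  [seq p <- [seq (i, j) | i <- iota 1 n.-2, j <- iota 1 n.-2] | (p.1 < p.2)%N].

Definition bounded_rel n (P : seq (nat * nat)) (i j : nat) : bool :=
  [|| i == j, i == 0%N, j == n.-1 | (i, j) \in P].

Section NaturalLabelling.
Context d (L : finLatticeType d) (n : nat).
Hypothesis cardL : #|L| = n.+1.

(** Larger elements have larger principal ideals, so sorting by their size gives a linear extension
    of the order. *)
Let rank (x : L) : nat := #|[pred y | y <= x]|.
Let s : seq L := sort (relpre rank leq) (enum L).

Fact element_exists : exists x : L, true.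
Proof. by have /card_gt0P [x _] : (0 < #|L|)%N by [rewrite cardL]; exists x. Qed.

Let x0 : L := xchoose element_exists.

Let mem_s x : x \in s. Proof. by rewrite mem_sort mem_enum. Qed.
Let size_s : size s = n.+1. Proof. by rewrite size_sort -cardE cardL. Qed.
Let uniq_s : uniq s. Proof. by rewrite sort_uniq enum_uniq. Qed.

Let rho (i j : nat) : bool := nth x0 s i <= nth x0 s j.

Definition natural_tabulated : tabulated L n.+1 rho.
Proof.
exists (nth x0 s) (index^~ s).
- by move=> x; apply: nth_index.
- by move=> k kn; apply: index_uniq; rewrite ?size_s.
- by move=> x; rewrite -size_s index_mem.
- by move=> x y; rewrite /rho !nth_index.
Qed.

(** If the larger element came first in the list, the two nested ideals would have equal size, hence
    coincide, and so would the elements. *)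
Let rho_leq i j : (i < n.+1)%N -> (j < n.+1)%N -> rho i j -> (i <= j)%N.
Proof.
move=> i_n j_n ij; rewrite leqNgt; apply/negP => ji.
have : (rank (nth x0 s i) <= rank (nth x0 s j))%N.
  by apply: subset_leq_card; apply/subsetP => y; rewrite !inE => /le_trans; apply.
have := @sorted_leq_nth _ (relpre rank leq) _ _ x0 s _ j i.
rewrite !inE !size_s => /(_ _ _ _ j_n i_n (ltnW ji)) srt h.
have rji : (rank (nth x0 s j) <= rank (nth x0 s i))%N.
  apply: srt; [by move=> ? ? ?; apply: leq_trans|by move=> ?; apply: leqnn|].
  by apply: sort_sorted => x y; apply: leq_total.
have e : [pred y | y <= nth x0 s i] =i [pred y | y <= nth x0 s j].
  apply/subset_cardP; first by apply/eqP; rewrite eqn_leq h rji.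
  by apply/subsetP => y; rewrite !inE => /le_trans; apply.
have : nth x0 s j <= nth x0 s i by have := e (nth x0 s j); rewrite !inE lexx.
move=> le_ji; have /eqP : nth x0 s i = nth x0 s j by apply/le_anti; rewrite le_ji andbT.
by rewrite nth_uniq ?size_s // => /eqP eij; rewrite eij ltnn in ji.
Qed.

Let rho0 j : (j < n.+1)%N -> rho 0 j.
Proof.
(* The meet of all elements is the least one; lying below the first of the list, it is the first by
   [rho_leq]. *)
move=> jn; pose b := foldr Order.meet x0 s.
have bP x : b <= x.
  rewrite /b; elim: s (mem_s x) => //= y t IH; rewrite inE => /orP [/eqP ->|/IH].
    exact: leIl.
  by apply: le_trans; apply: leIr.
rewrite /rho; have : rho (index b s) 0 by rewrite /rho nth_index // bP.
move=> /rho_leq; rewrite -{1}size_s index_mem mem_s leqn0 => /(_ isT isT) /eqP <-.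
by rewrite nth_index.
Qed.

Let rhon i : (i < n.+1)%N -> rho i n.
Proof.
move=> i_n; pose t := foldr Order.join x0 s.
have tP x : x <= t.
  rewrite /t; elim: s (mem_s x) => //= y u IH; rewrite inE => /orP [/eqP ->|/IH].
    exact: leUl.
  by move=> /le_trans; apply; apply: leUr.
rewrite /rho; have : rho n (index t s) by rewrite /rho [nth x0 s (index t s)]nth_index // tP.
have tn : (index t s < n.+1)%N by rewrite -size_s index_mem.
move=> /rho_leq; rewrite tn ltnSn => /(_ isT isT) nt.
have e : n = index t s by apply/eqP; rewrite eqn_leq nt -ltnS.
by rewrite e nth_index.
Qed.

Lemma natural_labelling :
  exists2 P, P \in subseqs (inner_pairs n.+1)
           & inhabited (tabulated L n.+1 (bounded_rel n.+1 P)).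
Proof.
exists [seq p <- inner_pairs n.+1 | rho p.1 p.2]; first exact: filter_subseqs.
have T := natural_tabulated; constructor.
apply: (@Tabulated _ L _ _ (tel T) (tcd T) (tcdK T) (telK T) (tcd_lt T)) => x y.
rewrite (tcd_le T); move: (tcd_lt T x) (tcd_lt T y).
move: (tcd T x) (tcd T y) => i j i_n j_n; rewrite /bounded_rel mem_filter /=.
case: eqP => [->|ij] /=; first by rewrite /rho lexx.
case: eqP => [->|i0] /=; first by rewrite rho0.
case: eqP => [->|jn] /=; first by rewrite rhon.
case: (boolP (rho i j)) => //= rij; rewrite mem_filter /=.
have lt_ij : (i < j)%N by rewrite ltn_neqAle rho_leq // andbT; apply/eqP.
rewrite lt_ij /=; apply/esym/allpairsP; exists (i, j); rewrite !mem_iota /=.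
by split=> //; lia.
Qed.

End NaturalLabelling.

Definition lattice_rel n (r : rel nat) : bool :=
  all (fun x => all (fun y => (cmeet n r x y < n)%N && (cjoin n r x y < n)%N)
    (iota 0 n)) (iota 0 n).

Lemma tabulated_lattice_rel d (L : latticeType d) n r : tabulated L n r -> lattice_rel n r.
Proof.
move=> T; apply/allP => i; rewrite mem_iota => /= i_n.
apply/allP => j; rewrite mem_iota => /= j_n.
by rewrite -(telK T i_n) -(telK T j_n) -(cmeetE T) -(cjoinE T) !tcd_lt.
Qed.

(** * The twelve lattices *)

(** Equality of tables turns the agreement of two relations below [n] into a single computation. *)
Definition diagram_tabulated n c (ok : check_diagram n c) r :
  (0 < n)%N -> tabulate n r = tabulate n (reach c n) ->
  tabulated (check_mk ok : latticeType _) n r.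
Proof.
move=> n_gt0 rE; pose D := check_mk ok.
pose el k : D := insubd (Ordinal n_gt0 : 'I_n) k : 'I_n.
pose cd (x : D) : nat := val (x : 'I_n).
apply: (@Tabulated _ D n r el cd).
- by move=> x; apply: valKd.
- by move=> k kn; rewrite /cd /el val_insubd kn.
- by move=> x; apply: ltn_ord.
- move=> x y; transitivity (reach c n (cd x) (cd y)).
    by apply: cov_leE; have /and5P [] := ok.
  by rewrite -[LHS](@lookE _ false n) ?ltn_ord // -rE lookE ?ltn_ord.
Qed.

Definition diagram_data : seq (nat * seq (nat * nat)) :=
  [seq (diag_size D, diag_cov D) | D <- nondistributive56].

Definition order_tables := Eval lazy in
  [seq tabulate p.1 (reach p.2 p.1) | p <- diagram_data].
Definition sizes := Eval vm_compute in unzip1 diagram_data.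

Definition dsize i : nat := nth 0 sizes i.
Definition dle i : rel nat := look false (nth [::] order_tables i).

Definition meet_tables := Eval vm_compute in
  [seq tabulate (dsize i) (cmeet (dsize i) (dle i)) | i <- iota 0 12].
Definition join_tables := Eval vm_compute in
  [seq tabulate (dsize i) (cjoin (dsize i) (dle i)) | i <- iota 0 12].

Definition dmeet i : nat -> nat -> nat := look 0%N (nth [::] meet_tables i).
Definition djoin i : nat -> nat -> nat := look 0%N (nth [::] join_tables i).

(** Increasing triples represent the orbits with distinct entries; a repeated entry forces the value
    by majority. *)
Definition free_tables := Eval vm_compute in
  [seq [seq t <- triples (dsize i) |
         [&& (t.1.1 < t.1.2)%N, (t.1.2 < t.2)%N
           & cterm (dmeet i) (djoin i) lower_term t != cterm (dmeet i) (djoin i) upper_term t]]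
  | i <- iota 0 12].

Definition dfree i : seq triple := nth [::] free_tables i.

Definition diag i : diagram := nth M3 nondistributive56 i.

Lemma diag_tab i : (i < 12)%N -> tabulated (diag i : latticeType _) (dsize i) (dle i).
Proof.
do 12?[case: i => [_|i]; first by apply: diagram_tabulated => //; vm_compute].
by [].
Qed.
Lemma diag_meetE i (i12 : (i < 12)%N) (x y : diag i : latticeType _) :
  let T := diag_tab i12 in tcd T (x `&` y) = dmeet i (tcd T x) (tcd T y).
Proof.
move=> T; rewrite cmeetE /dmeet.
have -> : nth [::] meet_tables i = tabulate (dsize i) (cmeet (dsize i) (dle i)).
  by do 12?[case: i i12 x y T => [|i] i12 x y T; first by lazy].
by rewrite lookE ?tcd_lt.
Qed.

Lemma diag_joinE i (i12 : (i < 12)%N) (x y : diag i : latticeType _) :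
  let T := diag_tab i12 in tcd T (x `|` y) = djoin i (tcd T x) (tcd T y).
Proof.
move=> T; rewrite cjoinE /djoin.
have -> : nth [::] join_tables i = tabulate (dsize i) (cjoin (dsize i) (dle i)).
  by do 12?[case: i i12 x y T => [|i] i12 x y T; first by lazy].
by rewrite lookE ?tcd_lt.
Qed.

Lemma diag_free i : (i < 12)%N -> check_free (dsize i) (dmeet i) (djoin i) (dfree i).
Proof. by do 12?[case: i => [_|i]; first by lazy]. Qed.

Definition dmedians i := cmedians (dsize i) (dle i) (dmeet i) (djoin i) (dfree i).

Lemma coded_OutMed_diag i : (i < 12)%N ->
  coded (OutMed (diag i)) (dmedians i) (all2 (dle i)).
Proof.
move=> i12; exact: (coded_OutMed (diag_meetE i12) (diag_joinE i12) (diag_free i12)).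
Qed.

(* Together with its dual, this term supplies the inner medians of A1, L4 and L5
   other than the lower and upper ones. *)
Definition mid_term : lterm :=
  let p := TMeet TX (TJoin TY TZ) in
  let q := TMeet TY (TJoin TX TZ) in
  let s := TMeet TZ (TJoin TX TY) in
  TJoin (TMeet TX (TJoin q s)) (TMeet TY (TJoin p s)).

Fixpoint term_dual (t : lterm) : lterm :=
  match t with
  | TMeet s t => TJoin (term_dual s) (term_dual t)
  | TJoin s t => TMeet (term_dual s) (term_dual t)
  | _ => t
  end.

Definition median_terms := [:: lower_term; upper_term; mid_term; term_dual mid_term].

Definition diag_inner i tss I :=
  check_inner (dsize i) (dle i) (dmeet i) (djoin i) (dfree i) tss median_terms I.

Lemma coded_InnMed_diag i tss I : (i < 12)%N -> diag_inner i tss I ->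
  coded (InnMed (diag i)) I (all2 (dle i)).
Proof.
move=> i12; exact: (coded_InnMed (diag_meetE i12) (diag_joinE i12) (diag_free i12)).
Qed.

Definition rename (l l' : seq (seq nat)) (v : seq nat) : seq nat := nth [::] l' (index v l).

(** * The median lattices of the twelve diagrams *)

Lemma OutMed_diag_iso i d (M : latticeType d) l r h : (i < 12)%N -> coded M l r ->
  iso_check (dmedians i) (all2 (dle i)) l r h -> lattice_iso (OutMed (diag i)) M.
Proof. by move=> i12; apply: iso_checkP; apply: coded_OutMed_diag. Qed.

Lemma InnMed_diag_iso i tss I d (M : latticeType d) l r h : (i < 12)%N -> coded M l r ->
  diag_inner i tss I && iso_check I (all2 (dle i)) l r h -> lattice_iso (InnMed (diag i)) M.
Proof.
by move=> i12 cM /andP [hI]; apply: iso_checkP cM; apply: coded_InnMed_diag hI.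
Qed.

(** The indices are those of M3, B1 and B2. A triple with a new bound is forced, so only abc is
    free, with the whole of M3 as its interval of values. *)
Lemma OutMed_M3_like i : i \in [:: 0; 8; 9]%N -> lattice_iso (OutMed (diag i)) M3.
Proof.
move=> iP; have i12 : (i < 12)%N by move: iP; rewrite !inE => /or3P [] /eqP ->.
apply: (@OutMed_diag_iso i _ M3 _ _ id i12 (tabulated_coded (@diag_tab 0 isT))).
by move: i iP {i12}; apply/allP; lazy.
Qed.

Lemma InnMed_M3_like i : i \in [:: 0; 8; 9]%N -> lattice_iso (InnMed (diag i)) 'I_2.
Proof.
move=> iP; have i12 : (i < 12)%N by move: iP; rewrite !inE => /or3P [] /eqP ->.
(* A median agrees on abc and bca, but the words ab, bc, ca generate a copy of M3 whose only
   constant words are its bounds. *)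
pose tss := [:: [:: (1, 2, 3); (2, 3, 1)]]%N.
pose I := [:: [:: 0]; [:: 4]]%N.
apply: (@InnMed_diag_iso i tss I _ _ _ _ (rename I (words 2 1)) i12 (coded_ord 2)).
by rewrite {}/tss {}/I; move: i iP {i12}; apply/allP; lazy.
Qed.

(** In N5, B3 and B4 only abc is free, with values in the two-element interval [a, c]. *)
Lemma OutMed_N5_like i : i \in [:: 1; 10; 11]%N -> lattice_iso (OutMed (diag i)) 'I_2.
Proof.
move=> iP; have i12 : (i < 12)%N by move: iP; rewrite !inE => /or3P [] /eqP ->.
pose I := [:: [:: 1]; [:: 3]]%N.
apply: (@OutMed_diag_iso i _ _ _ _ (rename I (words 2 1)) i12 (coded_ord 2)).
by rewrite {}/I; move: i iP {i12}; apply/allP; lazy.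
Qed.

Lemma InnMed_N5_like i : i \in [:: 1; 10; 11]%N -> lattice_iso (InnMed (diag i)) 'I_2.
Proof.
move=> iP; have i12 : (i < 12)%N by move: iP; rewrite !inE => /or3P [] /eqP ->.
pose I := [:: [:: 1]; [:: 3]]%N.
apply: (@InnMed_diag_iso i [::] I _ _ _ _ (rename I (words 2 1)) i12 (coded_ord 2)).
by rewrite {}/I; move: i iP {i12}; apply/allP; lazy.
Qed.

(** The four triples of distinct atoms are incomparable even up to permutation, and their bounds are
    0 and 1: the values are arbitrary and independent. *)
Lemma OutMed_M4 : lattice_iso (OutMed M4) ('I_4 -> M4).
Proof.
have T := @diag_tab 2 isT.
apply: (coded_iso (@coded_OutMed_diag 2 isT) (tabulated_pow T 4)).
have -> : dmedians 2 = words (dsize 2) 4 by lazy.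
by [].
Qed.

Lemma InnMed_M4 : lattice_iso (InnMed M4) 'I_2.
Proof.
(* The first list confines the value on abc to 0 and 1, as in M3; the others generate copies of M3
   with constant bounds and carry this value to abd, acd and bcd. *)
pose tss := [:: [:: (1, 2, 3); (2, 3, 1)]; [:: (1, 2, 3); (1, 2, 4)];
  [:: (1, 2, 3); (1, 3, 4)]; [:: (1, 3, 4); (2, 3, 4)]]%N.
pose I := [:: [:: 0; 0; 0; 0]; [:: 5; 5; 5; 5]]%N.
apply: (@InnMed_diag_iso 2 tss I _ _ _ _ (rename I (words 2 1)) isT (coded_ord 2)).
by lazy.
Qed.

(* The values on abc and acd lie in the two-element interval [a, c]; those on
   abd and bcd are free, apart from the former being at most the latter. *)
Lemma OutMed_A1 : lattice_iso (OutMed A1) (('I_2 *p 'I_2) *p MonMaps 'I_2 A1).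
Proof.
have c2 := coded_ord 2; have cM := tabulated_MonMaps2 (@diag_tab 3 isT).
have cP := @coded_prod _ _ _ _ 2 _ _ _ _ (@coded_prod _ _ _ _ 1 _ _ _ _ c2 c2 isT) cM isT.
pose h v := [:: nat_of_bool (nth 0 v 0 == 3); nat_of_bool (nth 0 v 2 == 3); nth 0 v 1;
                nth 0 v 3]%N.
by apply: (@OutMed_diag_iso 3 _ _ _ _ h isT cP); lazy.
Qed.

Lemma card_OutMed_A1 : exists f : 'I_64 -> OutMed A1, bijective f.
Proof.
have [s64 uA1] : size (dmedians 3) = 64 /\ uniq (dmedians 3) by lazy.
by have := coded_bij uA1 (@coded_OutMed_diag 3 isT); rewrite s64.
Qed.

Lemma InnMed_A1 : lattice_iso (InnMed A1) ('I_2 *p 'I_2).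
Proof.
have cP := @coded_prod _ _ _ _ 1 _ _ _ _ (coded_ord 2) (coded_ord 2) isT.
(* The first list generates a copy of M3 and, with monotonicity, makes the values on abd and bcd
   both 0 or both 1; the second generates a copy of N5 and makes those on abc and acd agree. *)
pose tss := [:: [:: (1, 2, 4); (2, 4, 3)]; [:: (1, 2, 3); (1, 4, 3)]]%N.
pose I := [:: [:: 1; 0; 1; 0]; [:: 1; 5; 1; 5]; [:: 3; 0; 3; 0]; [:: 3; 5; 3; 5]]%N.
by apply: (@InnMed_diag_iso 3 tss I _ _ _ _ (rename I (words 2 2)) isT cP); lazy.
Qed.

(** The values on abc and acd form a monotone pair in {a, c}, those on abd and bcd one in {b, d};
    each pair is given by the number of its larger entries. *)
Lemma OutMed_A2 : lattice_iso (OutMed A2) ('I_3 *p 'I_3).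
Proof.
have cP := @coded_prod _ _ _ _ 1 _ _ _ _ (coded_ord 3) (coded_ord 3) isT.
pose h v := [:: (nth 0 v 0 == 3) + (nth 0 v 2 == 3); (nth 0 v 1 == 4) + (nth 0 v 3 == 4)]%N.
by apply: (@OutMed_diag_iso 4 _ _ _ _ h isT cP); lazy.
Qed.

Lemma InnMed_A2 : lattice_iso (InnMed A2) 'I_2.
Proof.
(* Both lists generate copies of N5: one ties the value on abc to that on bcd, the other abd to acd,
   and monotonicity closes the cycle. *)
pose tss := [:: [:: (1, 2, 3); (2, 3, 4)]; [:: (1, 2, 4); (4, 1, 3)]]%N.
pose I := [:: [:: 1; 2; 1; 2]; [:: 3; 4; 3; 4]]%N.
by apply: (@InnMed_diag_iso 4 tss I _ _ _ _ (rename I (words 2 1)) isT (coded_ord 2)); lazy.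
Qed.

(** The free triples abc, abd, cbd increase and take values in [a, c], [a, d], [c, d]; in
    lexicographic order the eight monotone words are p_1, ..., p_8. *)
Lemma OutMed_A3 : lattice_iso (OutMed A3) P8.
Proof.
have T8 : tabulated (P8 : latticeType _) 8 (reach (diag_cov P8) 8).
  exact: diagram_tabulated.
pose h := rename (dmedians 5) (words 8 1).
by apply: (@OutMed_diag_iso 5 _ _ _ _ h isT (tabulated_coded T8)); lazy.
Qed.

Lemma InnMed_A3 : lattice_iso (InnMed A3) 'I_2.
Proof.
(* The generated copy of N5 contains only two words within the bounds, those of the lower and upper
   medians. *)
pose tss := [:: [:: (1, 2, 3); (1, 2, 4); (3, 2, 4)]]%N.
pose I := [:: [:: 1; 1; 3]; [:: 3; 4; 4]]%N.
by apply: (@InnMed_diag_iso 5 tss I _ _ _ _ (rename I (words 2 1)) isT (coded_ord 2)); lazy.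
Qed.

Lemma OutMed_L4 : lattice_iso (OutMed L4) ('I_3 *p 'I_3).
Proof.
have cP := @coded_prod _ _ _ _ 1 _ _ _ _ (coded_ord 3) (coded_ord 3) isT.
(* The first digit counts the values on abc and acd that lie above b, the second those on abc and
   bcd that lie above a. *)
pose h := rename (dmedians 6) [:: [:: 0; 0]; [:: 0; 1]; [:: 1; 0]; [:: 1; 1]; [:: 0; 2];
  [:: 1; 2]; [:: 2; 0]; [:: 2; 1]; [:: 2; 2]]%N.
by apply: (@OutMed_diag_iso 6 _ _ _ _ h isT cP); lazy.
Qed.

Lemma InnMed_L4 : lattice_iso (InnMed L4) 'I_3.
Proof.
(* A copy of N5 ties the values on acd and bcd; exchanging a and b gives a copy of L4, whose
   constant words exclude a and b as values on abc. *)
pose tss := [:: [:: (1, 3, 4); (2, 3, 4)]; [:: (1, 2, 3); (2, 1, 3)]]%N.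
pose I := [:: [:: 0; 1; 2]; [:: 0; 4; 4]; [:: 4; 4; 4]]%N.
by apply: (@InnMed_diag_iso 6 tss I _ _ _ _ (rename I (words 3 1)) isT (coded_ord 3)); lazy.
Qed.

Lemma OutMed_L5 : lattice_iso (OutMed L5) ('I_3 *p 'I_3).
Proof.
have cP := @coded_prod _ _ _ _ 1 _ _ _ _ (coded_ord 3) (coded_ord 3) isT.
(* L5 has the labels of L4 with the order reversed, so each digit is 2 minus the one used for L4. *)
pose h := rename (dmedians 7) [:: [:: 2; 2]; [:: 2; 1]; [:: 1; 2]; [:: 1; 1]; [:: 2; 0];
  [:: 1; 0]; [:: 0; 2]; [:: 0; 1]; [:: 0; 0]]%N.
by apply: (@OutMed_diag_iso 7 _ _ _ _ h isT cP); lazy.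
Qed.

Lemma InnMed_L5 : lattice_iso (InnMed L5) 'I_3.
Proof.
pose tss := [:: [:: (1, 3, 4); (2, 3, 4)]; [:: (1, 2, 3); (2, 1, 3)]]%N.
pose I := [:: [:: 4; 4; 4]; [:: 0; 4; 4]; [:: 0; 1; 2]]%N.
by apply: (@InnMed_diag_iso 7 tss I _ _ _ _ (rename I (words 3 1)) isT (coded_ord 3)); lazy.
Qed.

(** * Classification of the nondistributive lattices with 5 or 6 elements *)

Definition candidates i : seq (seq nat) :=
  let it := iota 0 (dsize i) in
  (* An isomorphism matches the bounds, so only the other elements are permuted. The bounds are
     searched for because in L5, B2 and B4 the least element has label 5. *)
  let b := find (fun x => all (dle i x) it) it in
  let t := find (fun x => all (dle i ^~ x) it) it in
  [seq b :: rcons q t | q <- permutations [seq x <- it | (x != b) && (x != t)]].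

Definition classified n P : bool :=
  let r := bounded_rel n P in
  [|| ~~ lattice_rel n r, cdistributive n r
    | has (fun i => has (fun p =>
        iso_check (words n 1) (all2 r) (words (dsize i) 1) (all2 (dle i))
          (fun v => [:: nth 0%N p (head 0%N v)]))
      (candidates i)) [seq i <- iota 0 12 | dsize i == n]].

Lemma all_classified n : n \in [:: 5; 6]%N -> all (classified n) (subseqs (inner_pairs n)).
Proof. by move: n; apply/allP; lazy. Qed.

Lemma nondistributive_iso_diag d (L : finLatticeType d) :
  #|L| = 5 \/ #|L| = 6 -> ~ distributive_lattice L ->
  exists2 i, (i < 12)%N & lattice_iso L (diag i).
Proof.
move=> cardL ndL.
have [n [n56 [P Pn [T]]]] : exists n, n \in [:: 5; 6]%N /\
    exists2 P, P \in subseqs (inner_pairs n) & inhabited (tabulated L n (bounded_rel n P)).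
  by case: cardL => c; [exists 5|exists 6]; split=> //; apply: natural_labelling.
have := allP (all_classified n56) _ Pn.
rewrite /classified (tabulated_lattice_rel T) orFb => /orP [/cdistributiveP|].
  by move=> /(_ _ _ T) /ndL.
case/hasP => i; rewrite mem_filter mem_iota => /andP [_ /= i12] /hasP [p _ hp].
by exists i => //; apply: iso_checkP hp; apply: tabulated_coded => //; apply: diag_tab.
Qed.

Lemma diag_iso_nondistributive d (L : finLatticeType d) i : (i < 12)%N ->
  lattice_iso L (diag i) -> (#|L| = 5 \/ #|L| = 6) /\ ~ distributive_lattice L.
Proof.
move=> i12 isoL; split.
  have [f /bij_eq_card ->] := isoL; rewrite (tabulated_card (diag_tab i12)).
  by move: i12 {isoL f}; do 12?[case: i => [_|i]; first by [left|right]].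
move/(iso_distributive isoL)/(cdistributiveP (diag_tab i12)); apply/negP.
have : all (fun i => ~~ cdistributive (dsize i) (dle i)) (iota 0 12) by lazy.
by move/allP; apply; rewrite mem_iota.
Qed.

Lemma diag_iso_inj i j : (i < 12)%N -> (j < 12)%N -> lattice_iso (diag i) (diag j) -> i = j.
Proof.
move=> i12 j12 /(iso_degrees (diag_tab i12) (diag_tab j12)) ij.
have : allrel (fun i j => perm_eq (degrees (dsize i) (dle i)) (degrees (dsize j) (dle j)) ==>
  (i == j)) (iota 0 12) (iota 0 12) by lazy.
by move/allrelP/(_ i j); rewrite !mem_iota ij => /(_ i12 j12) /eqP.
Qed.

Theorem mainTheorem1 :
  (* classification, up to isomorphism *)
  (forall (d : Order.disp_t) (L : finLatticeType d),
     ((#|L| = 5 \/ #|L| = 6) /\ ~ distributive_lattice L) <->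
     exists i : 'I_12, lattice_iso L (tnth nondistributive56 i)) /\
  (forall i j : 'I_12, i <> j ->
     ~ lattice_iso (tnth nondistributive56 i) (tnth nondistributive56 j)) /\
  (* outer and inner median lattices *)
  (lattice_iso (OutMed M3) M3 /\ lattice_iso (InnMed M3) 'I_2) /\
  (lattice_iso (OutMed N5) 'I_2 /\ lattice_iso (InnMed N5) 'I_2) /\
  (lattice_iso (OutMed M4) ('I_4 -> M4) /\ lattice_iso (InnMed M4) 'I_2) /\
  (lattice_iso (OutMed A1) (('I_2 *p 'I_2) *p MonMaps 'I_2 A1) /\
   (exists f : 'I_64 -> OutMed A1, bijective f) /\
   lattice_iso (InnMed A1) ('I_2 *p 'I_2)) /\
  (lattice_iso (OutMed A2) ('I_3 *p 'I_3) /\ lattice_iso (InnMed A2) 'I_2) /\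
  (lattice_iso (OutMed A3) P8 /\ lattice_iso (InnMed A3) 'I_2) /\
  (lattice_iso (OutMed L4) ('I_3 *p 'I_3) /\ lattice_iso (InnMed L4) 'I_3) /\
  (lattice_iso (OutMed L5) ('I_3 *p 'I_3) /\ lattice_iso (InnMed L5) 'I_3) /\
  (lattice_iso (OutMed B1) M3 /\ lattice_iso (InnMed B1) 'I_2) /\
  (lattice_iso (OutMed B2) M3 /\ lattice_iso (InnMed B2) 'I_2) /\
  (lattice_iso (OutMed B3) 'I_2 /\ lattice_iso (InnMed B3) 'I_2) /\
  (lattice_iso (OutMed B4) 'I_2 /\ lattice_iso (InnMed B4) 'I_2).
Proof.
split; [|split].
- move=> d L; split=> [[cardL ndL]|[i]].
    have [i i12 isoL] := nondistributive_iso_diag cardL ndL.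
    by exists (Ordinal i12); rewrite (tnth_nth M3).
  by rewrite (tnth_nth M3); apply: diag_iso_nondistributive.
- move=> i j ij; rewrite !(tnth_nth M3) => /diag_iso_inj e.
  by apply: ij; apply: val_inj; apply: e.
have oM i h := @OutMed_M3_like i h; have iM i h := @InnMed_M3_like i h.
have oN i h := @OutMed_N5_like i h; have iN i h := @InnMed_N5_like i h.
split; first by split; [exact: (oM 0 isT)|exact: (iM 0 isT)].
split; first by split; [exact: (oN 1 isT)|exact: (iN 1 isT)].
split; first by split; [exact: OutMed_M4|exact: InnMed_M4].
split; first by split; [exact: OutMed_A1|split; [exact: card_OutMed_A1|exact: InnMed_A1]].
split; first by split; [exact: OutMed_A2|exact: InnMed_A2].
split; first by split; [exact: OutMed_A3|exact: InnMed_A3].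
split; first by split; [exact: OutMed_L4|exact: InnMed_L4].
split; first by split; [exact: OutMed_L5|exact: InnMed_L5].
split; first by split; [exact: (oM 8 isT)|exact: (iM 8 isT)].
split; first by split; [exact: (oM 9 isT)|exact: (iM 9 isT)].
split; first by split; [exact: (oN 10 isT)|exact: (iN 10 isT)].
by split; [exact: (oN 11 isT)|exact: (iN 11 isT)].
Qed.
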